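(* Let $M,p,d\ge 1$ be integers, let $\mathcal{Y}\in\mathbb{R}^{M\times Q_1\times\cdots\times Q_d}$, and for $j=1,\dots,p$ let $\mathcal{X}_j\in\mathbb{R}^{M\times P_{j1}\times\cdots\times P_{jl_j}}$, $\boldsymbol{U}_{jr}\in\mathbb{R}^{P_{jr}\times\tilde P_{jr}}$ ($r=1,\dots,l_j$) and $\mathcal{C}_j\in\mathbb{R}^{\tilde P_{j1}\times\cdots\times\tilde P_{jl_j}\times\tilde Q_1\times\cdots\times\tilde Q_d}$ be given, where $\tilde Q_k\le Q_k$ for $k=1,\dots,d$. Fix $i\in\{1,\dots,d\}$ and let $\boldsymbol{V}_k\in\mathbb{R}^{Q_k\times\tilde Q_k}$ be given for all $k\neq i$. For $\boldsymbol{V}_i\in\mathbb{R}^{Q_i\times\tilde Q_i}$ put $$\mathcal{B}_j=\mathcal{C}_j\times_1\boldsymbol{U}_{j1}\times_2\cdots\times_{l_j}\boldsymbol{U}_{jl_j}\times_{l_j+1}\boldsymbol{V}_1\times_{l_j+2}\cdots\times_{l_j+d}\boldsymbol{V}_d\qquad(j=1,\dots,p).$$ Define $\boldsymbol{Z}_j=\boldsymbol{X}_{j(1)}\left(\boldsymbol{U}_{jl_j}\otimes\cdots\otimes\boldsymbol{U}_{j1}\right)$, $$\boldsymbol{S}_j=\tilde{\boldsymbol{C}}_{j[i]}\left(\boldsymbol{V}_d\otimes\cdots\otimes\boldsymbol{V}_{i+1}\otimes\boldsymbol{V}_{i-1}\otimes\cdots\otimes\boldsymbol{V}_1\otimes\boldsymbol{Z}_j\right)^{\mathtt{T}},\qquad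 \boldsymbol{S}=\sum_{j=1}^{p}\boldsymbol{S}_j ,$$ and let $\boldsymbol{Y}_{[i]}\boldsymbol{S}^{\mathtt{T}}=\boldsymbol{R}\boldsymbol{D}\boldsymbol{W}^{\mathtt{T}}$ be a truncated (thin) singular value decomposition of the $Q_i\times\tilde Q_i$ matrix $\boldsymbol{Y}_{[i]}\boldsymbol{S}^{\mathtt{T}}$, i.e. $\boldsymbol{R}\in\mathbb{R}^{Q_i\times\tilde Q_i}$ has orthonormal columns, $\boldsymbol{D}\in\mathbb{R}^{\tilde Q_i\times\tilde Q_i}$ is diagonal with nonnegative entries, and $\boldsymbol{W}\in\mathbb{R}^{\tilde Q_i\times\tilde Q_i}$ is orthogonal. Then $$\boldsymbol{V}_i=\boldsymbol{R}\boldsymbol{W}^{\mathtt{T}}$$ is a solution of $$\min_{\boldsymbol{V}_i\in\mathbb{R}^{Q_i\times\tilde Q_i}}\ \left\|\boldsymbol{Y}_{(1)}-\sum_{j=1}^{p}\boldsymbol{X}_{j(1)}\boldsymbol{B}_j\right\|_F^2\quad\text{subject to}\quad \boldsymbol{V}_i^{\mathtt{T}}\boldsymbol{V}_i=\boldsymbol{I}_{\tilde Q_i}.$$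
   Context: All tensors are real. $\|\cdot\|_F$ is the Frobenius norm, $\otimes$ is the Kronecker product of matrices, and $\boldsymbol{I}_n$ is the $n\times n$ identity matrix. Mode product: for $\mathcal{R}\in\mathbb{R}^{I_1\times\cdots\times I_n}$ and $\boldsymbol{A}\in\mathbb{R}^{L\times I_m}$, $\mathcal{R}\times_m\boldsymbol{A}$ is the tensor obtained by replacing mode $m$ of size $I_m$ by a mode of size $L$, with entries $(\mathcal{R}\times_m\boldsymbol{A})_{i_1,\dots,i_{m-1},l,i_{m+1},\dots,i_n}=\sum_{i_m=1}^{I_m}\mathcal{R}_{i_1,\dots,i_n}\boldsymbol{A}_{l,i_m}$. Linearization convention: whenever several modes of sizes $N_1,\dots,N_r$ are merged into a single index, the multi-index $(n_1,\dots,n_r)$ is sent to $1+\sum_{s=1}^{r}(n_s-1)\prod_{t<s}N_t$ (first index varies fastest). Matricization: $\boldsymbol{R}_{(m)}\in\mathbb{R}^{I_m\times\prod_{s\ne m}I_s}$ is the mode-$m$ matricization of $\mathcal{R}$: its row index is the mode-$m$ index and its column index is the linearization of the remaining indices in increasing order of mode. In particular $\boldsymbol{Y}_{(1)}\in\mathbb{R}^{M\times Q}$ and $\boldsymbol{X}_{j(1)}\in\mathbb{R}^{M\times P_j}$, where $Q=\prod_{k=1}^{d} Q_k$, $P_j=\prod_{r=1}^{l_j}P_{jr}$, and the first mode is the sample mode. The matrix $\boldsymbol{B}_j\in\mathbb{R}^{P_j\times Q}$ is the unfolding of $\mathcal{B}_j\in\mathbb{R}^{P_{j1}\times\cdots\times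 P_{jl_j}\times Q_1\times\cdots\times Q_d}$ whose row index linearizes the first $l_j$ modes and whose column index linearizes the last $d$ modes. Reshaped core: $\tilde{\mathcal{C}}_j\in\mathbb{R}^{\tilde P_j\times\tilde Q_1\times\cdots\times\tilde Q_d}$, with $\tilde P_j=\prod_{r=1}^{l_j}\tilde P_{jr}$, is the $(d+1)$-mode tensor obtained from $\mathcal{C}_j$ by merging its first $l_j$ modes into a single mode (with the linearization convention above). Matricization along the $i$-th output mode: $\boldsymbol{Y}_{[i]}\in\mathbb{R}^{Q_i\times M\prod_{k\neq i}Q_k}$ and $\tilde{\boldsymbol{C}}_{j[i]}\in\mathbb{R}^{\tilde Q_i\times\tilde P_j\prod_{k\neq i}\tilde Q_k}$ denote the matricizations of $\mathcal{Y}$ and $\tilde{\mathcal{C}}_j$ along the mode of size $Q_i$, respectively $\tilde Q_i$ (the mode at position $i+1$, since position $1$ is the sample mode of $\mathcal{Y}$, respectively the merged mode of $\tilde{\mathcal{C}}_j$). *)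

(* Defs.v *)
From HB Require Import structures.
From mathcomp Require Import all_boot all_order all_algebra.
From mathcomp Require Import mxtens.
From mathcomp Require Import reals.

Set Implicit Arguments.
Unset Strict Implicit.
Unset Printing Implicit Defensive.

Import Order.TTheory GRing.Theory Num.Theory.
Local Open Scope ring_scope.

(* The modes of a tensor are indexed by a finType K and are ordered as in     *)
(* [enum K]; mode k has size I k. Order-n tensors use K = 'I_n. Two           *)
(* enumeration orders matter below: [option 'I_d] lists None first (a         *)
(* distinguished leading mode followed by d modes), and ['I_l + 'I_d] lists   *)
(* the l left modes before the d right ones; see enum_optionE, enum_sumE.     *)
Definition midx (K : finType) (I : K -> nat) : finType :=
  {dffun forall k : K, 'I_(I k)}.

Definition tensor (R : Type) (K : finType) (I : K -> nat) : Type :=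
  midx I -> R.

Definition cons_dims (K : finType) (M : nat) (Q : K -> nat) (o : option K) :
    nat :=
  if o is Some k then Q k else M.

Definition cat_dims (K L : finType) (P : K -> nat) (Q : L -> nat)
    (s : K + L) : nat :=
  match s with inl r => P r | inr k => Q k end.

Lemma enum_optionE (K : finType) :
  enum {: option K} = None :: [seq Some k | k <- enum K].
Proof. by rewrite !enumT [in LHS]unlock. Qed.

Lemma enum_sumE (K L : finType) :
  enum {: K + L} = [seq inl k | k <- enum K] ++ [seq inr k | k <- enum L].
Proof. by rewrite !enumT [in LHS]unlock. Qed.

(* All modes but m, in the order of K.                                        *)
Definition others (K : finType) (m : K) : finType := {k : K | k != m}.

Lemma enum_othersE (K : finType) (m : K) :
  [seq val k | k <- enum {: others m}] = [seq k <- enum K | k != m].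
Proof.
rewrite !enumT [in LHS]unlock /= pmap_filter; last exact: insubK.
by apply: eq_filter => k; rewrite isSome_insub.
Qed.

Section ModeProducts.
Variables (R : nzRingType) (K : finType).

(* T x_m A, for J obtained from I by changing the size of mode m only. The    *)
(* multi-index [mode_src] of T agrees with j away from m and has a at m.      *)
Definition mode_src (I J : K -> nat) (m : K)
    (off : forall k, k <> m -> J k = I k) (j : midx J) (a : 'I_(I m)) :
    midx I :=
  [ffun k => match k =P m with
             | ReflectT e => ecast h 'I_(I h) (esym e) a
             | ReflectF ne => cast_ord (off k ne) (j k)
             end].

Definition mode_prod (I J : K -> nat) (m : K)
    (off : forall k, k <> m -> J k = I k) (A : 'M[R]_(J m, I m))
    (T : tensor R I) : tensor R J :=
  fun j => \sum_(a < I m) T (mode_src off j a) * A (j m) a.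

Variables I J : K -> nat.

(* Mode sizes once the modes in s have been multiplied.                       *)
Definition mixed_dims (s : seq K) (k : K) : nat :=
  if k \in s then J k else I k.

Lemma mixed_in s k : k \in s -> J k = mixed_dims s k.
Proof. by rewrite /mixed_dims => ->. Qed.

Lemma mixed_notin s k : k \notin s -> I k = mixed_dims s k.
Proof. by rewrite /mixed_dims => /negPf ->. Qed.

Lemma mixed_cons m s k : k <> m -> mixed_dims (m :: s) k = mixed_dims s k.
Proof. by rewrite /mixed_dims inE => /eqP/negPf ->. Qed.

Lemma uniq_notin (m : K) s : uniq (m :: s) -> m \notin s.
Proof. by case/andP. Qed.

Lemma uniq_tail (m : K) s : uniq (m :: s) -> uniq s.
Proof. by case/andP. Qed.

Variable A : forall k : K, 'M[R]_(J k, I k).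

(* Successive mode products along the modes of s, the last one of s first.    *)
Fixpoint mode_prods (s : seq K) :
    uniq s -> tensor R I -> tensor R (mixed_dims s) :=
  match s with
  | [::] => fun _ T => T
  | m :: s' => fun us T =>
      mode_prod (@mixed_cons m s')
        (castmx (mixed_in (mem_head m s'), mixed_notin (uniq_notin us)) (A m))
        (mode_prods (uniq_tail us) T)
  end.

Lemma rev_enum_uniq : uniq (rev (enum K)).
Proof. by rewrite rev_uniq enum_uniq. Qed.

Lemma mem_rev_enum (k : K) : k \in rev (enum K).
Proof. by rewrite mem_rev mem_enum. Qed.

(* T x_{k_1} A_{k_1} x_{k_2} ... x_{k_n} A_{k_n}, with k_1, ..., k_n the modes *)
(* in order.                                                                  *)
Definition multi_mode_prod (T : tensor R I) : tensor R J :=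
  fun j => mode_prods rev_enum_uniq T
             [ffun k => cast_ord (mixed_in (mem_rev_enum k)) (j k)].

End ModeProducts.

Section MultiModeProdEntries.
Variables (R : comNzRingType) (K : finType) (I J : K -> nat).
Variable A : forall k : K, 'M[R]_(J k, I k).

Lemma mode_srcE (I' J' : K -> nat) (m : K)
    (off : forall k, k <> m -> J' k = I' k) (j : midx J') (a : 'I_(I' m)) k :
  mode_src off j a k = (if k == m then a : nat else j k) :> nat.
Proof. by rewrite ffunE; case: eqP => //= e; case: m / e off a. Qed.

Let mode_prodsE (s : seq K) (us : uniq s) (T : tensor R I)
    (j : midx (mixed_dims I J s)) (y : midx J) (z : K -> nat) :
    (forall k, k \in s -> y k = j k :> nat) ->
    (forall k, k \notin s -> z k = j k) ->
  mode_prods A us T j =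
  \sum_(x : midx I | [forall k, (k \notin s) ==> (x k == z k :> nat)])
    T x * \prod_(k <- s) A k (y k) (x k).
Proof.
elim: s us j z => [|m s IHs] us j z yj zj /=.
  rewrite (big_pred1 j) ?big_nil ?mulr1 // => x /=.
  apply/forallP/eqP => [xz|-> k]; last exact/eqP/esym/zj.
  apply/ffunP => k; apply: val_inj.
  by have /eqP xzk := xz k; apply: etrans xzk (zj k _).
rewrite /mode_prod (partition_big (fun x : midx I => x m) xpredT) //=.
rewrite (reindex (cast_ord (mixed_notin I J (uniq_notin us)))) /=; last first.
  exact/onW_bij/(Bijective (cast_ordK _) (cast_ordKV _)).
apply: eq_bigr => a _.
pose z' k := if k == m then nat_of_ord a else z k.
rewrite (IHs _ _ z').
- rewrite big_distrl /=; apply: eq_big => [x|x /forallP xz].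
    apply/forallP/andP => [xz|[/forallP xz /eqP xm] k].
      split; last first.
        have := xz m; rewrite /z' eqxx (uniq_notin us) /=; exact.
      apply/forallP => k; apply/implyP; rewrite inE negb_or => /andP[km ks].
      by have := xz k; rewrite /z' ks (negPf km).
    apply/implyP => ks; rewrite /z'; case: (k =P m) => [->|/eqP km].
      by rewrite xm.
    by have := xz k; rewrite inE negb_or km ks.
  rewrite big_cons castmxE -mulrA; congr (_ * _).
  rewrite mulrC; congr (_ * _); congr (A m _ _).
    by apply: val_inj; rewrite /= yj // mem_head.
  apply: val_inj => /=.
  by have := xz m; rewrite /z' eqxx (uniq_notin us) /= => /eqP ->.
- move=> k ks; rewrite mode_srcE yj ?inE ?ks ?orbT //.
  have /negPf -> // : k != m.
  by apply: contraTneq ks => ->; apply: uniq_notin us.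
- move=> k ks; rewrite mode_srcE /z'; case: eqVneq => //= km.
  by rewrite zj // inE negb_or km.
Qed.

Lemma multi_mode_prodE (T : tensor R I) (j : midx J) :
  multi_mode_prod A T j =
  \sum_(x : midx I) T x * \prod_k A k (j k) (x k).
Proof.
rewrite /multi_mode_prod (@mode_prodsE _ _ _ _ j (fun=> 0%N)).
- apply: eq_big => [x|x _].
    by apply/forallP => k; rewrite mem_rev_enum.
  congr (_ * _); rewrite -[RHS]big_enum; apply: perm_big.
  by rewrite perm_rev.
- by move=> k _; rewrite ffunE.
- by move=> k; rewrite mem_rev_enum.
Qed.

End MultiModeProdEntries.

Section Linearization.
Variables (S : finType).

(* N_{k_1} * ... * N_{k_r} for the listed modes k_1, ..., k_r. The recursion  *)
(* has the shape of the dimensions of [_ *t _] so that no cast is needed.     *)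
Fixpoint merged_size_seq (N : S -> nat) (s : seq S) : nat :=
  if s is k :: s' then (merged_size_seq N s' * N k)%N else 1%N.

Definition merged_size (N : S -> nat) : nat := merged_size_seq N (enum S).

(* 0-based, first listed index fastest: x_{k_1} + N_{k_1} * (x_{k_2} + ...);  *)
(* closed form in linearizeE.                                                 *)
Fixpoint linearize_seq (N : S -> nat) (x : forall k, 'I_(N k)) (s : seq S) :
    'I_(merged_size_seq N s) :=
  match s with
  | [::] => ord0
  | k :: s' => mxtens_index (linearize_seq x s', x k)
  end.

Definition linearize (N : S -> nat) (x : forall k, 'I_(N k)) :
    'I_(merged_size N) :=
  linearize_seq x (enum S).

Lemma merged_sizeE (N : S -> nat) : merged_size N = (\prod_k N k)%N.
Proof.
rewrite -big_enum /merged_size; elim: (enum S) => [|k s IHs] /=.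
  by rewrite big_nil.
by rewrite big_cons IHs mulnC.
Qed.

Lemma linearizeE (N : S -> nat) (x : forall k, 'I_(N k)) :
  linearize x =
  (\sum_k x k * \prod_(t | index t (enum S) < index k (enum S)) N t)%N :> nat.
Proof.
pose c s k := (\prod_(t <- s | (index t s < index k s)%N) N t)%N.
suff H s : uniq s -> linearize_seq x s = (\sum_(k <- s) x k * c s k)%N :> nat.
  rewrite [LHS]H ?enum_uniq // big_enum; apply: eq_bigr => k _.
  by rewrite /c big_enum_cond.
elim: s => [|k s IHs] /=; first by rewrite big_nil.
rewrite {}/c in IHs *.
case/andP=> kNs us; rewrite IHs // big_cons big_distrl /= addnC; congr addn.
  rewrite eqxx big_pred0 ?muln1 // => t; exact: ltn0.
apply: eq_big_seq => t ts; rewrite big_cons eqxx.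
have -> /= : (k == t) = false by apply: contraNF kNs => /eqP ->.
rewrite -mulnA; congr muln; rewrite mulnC; congr muln.
rewrite big_seq_cond [RHS]big_seq_cond; apply: eq_bigl => h.
case hs: (h \in s) => //=.
by have -> : (k == h) = false by apply: contraNF kNs => /eqP ->.
Qed.

Lemma linearize_eqP (N : S -> nat) (x y : forall k, 'I_(N k)) :
  linearize x = linearize y <-> forall k, x k = y k.
Proof.
split=> [|eqxy]; last first.
  rewrite /linearize /merged_size.
  by elim: (enum S) => //= k s ->; rewrite eqxy.
suff H s : linearize_seq x s = linearize_seq y s ->
    forall k, k \in s -> x k = y k.
  by move=> /H eqxy k; apply: eqxy; rewrite mem_enum.
elim: s => //= h s IHs /(can_inj (@mxtens_indexK _ _)) [eq_s eq_h] k.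
by rewrite inE; case: eqP => [->|_] //=; apply: IHs.
Qed.

Lemma linearize_bij (N : S -> nat) :
  bijective (fun x : midx N => linearize x).
Proof.
apply: inj_card_bij.
  by move=> x y /linearize_eqP eqxy; apply/ffunP.
rewrite card_ord merged_sizeE card_dep_ffun foldrE big_map big_enum /=.
by under [X in (_ <= X)%N]eq_bigr do rewrite card_ord.
Qed.

(* A_{k_r} (x) ... (x) A_{k_1}, with a harmless leading factor 1%:M : 'M_1;    *)
(* [_ *t _] is the Kronecker product.                                         *)
Fixpoint kron_rev_seq (R : nzRingType) (I J : S -> nat)
    (A : forall k, 'M[R]_(I k, J k)) (s : seq S) :
    'M[R]_(merged_size_seq I s, merged_size_seq J s) :=
  match s with
  | [::] => 1%:M
  | k :: s' => kron_rev_seq A s' *t A k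
  end.

Definition kron_rev (R : nzRingType) (I J : S -> nat)
    (A : forall k, 'M[R]_(I k, J k)) :
    'M[R]_(merged_size I, merged_size J) :=
  kron_rev_seq A (enum S).

Lemma kron_revE (R : comNzRingType) (I J : S -> nat)
    (A : forall k, 'M[R]_(I k, J k)) (x : midx I) (y : midx J) :
  kron_rev A (linearize x) (linearize y) = \prod_k A k (x k) (y k).
Proof.
rewrite -big_enum /kron_rev /linearize /merged_size.
elim: (enum S) => [|k s IHs] /=.
  by rewrite big_nil mxE.
by rewrite tensmxE IHs big_cons mulrC.
Qed.

End Linearization.

Section Unfoldings.
Variable R : nzRingType.

(* In each of the next three definitions the sum has exactly one term, since  *)
(* linearization is a bijection: see matricizeE, unfold_mxE, merge_leadE.     *)

(* Mode-m matricization; e : S -> K lists the modes other than m in           *)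
(* increasing order.                                                          *)
Definition matricize (K S : finType) (I : K -> nat) (m : K) (e : S -> K)
    (T : tensor R I) : 'M[R]_(I m, merged_size (fun s => I (e s))) :=
  \matrix_(a, c)
    \sum_(x : midx I | (x m == a) && (linearize (fun s => x (e s)) == c)) T x.

Definition mat_lead (K : finType) (M : nat) (Q : K -> nat)
    (T : tensor R (cons_dims M Q)) : 'M[R]_(M, merged_size Q) :=
  matricize (I := cons_dims M Q) None Some T.

Definition mat_at (K : finType) (M : nat) (Q : K -> nat) (i : K)
    (T : tensor R (cons_dims M Q)) :
    'M[R]_(Q i, merged_size (fun o : others (Some i) =>
                               cons_dims M Q (val o))) :=
  matricize (I := cons_dims M Q) (Some i)
    (fun o : others (Some i) => val o) T.

Definition unfold_mx (K L : finType) (P : K -> nat) (Q : L -> nat)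
    (T : tensor R (cat_dims P Q)) : 'M[R]_(merged_size P, merged_size Q) :=
  \matrix_(a, c)
    \sum_(x : midx (cat_dims P Q) |
      (linearize (N := P) (fun r => x (inl r)) == a) &&
      (linearize (N := Q) (fun k => x (inr k)) == c)) T x.

Definition merge_lead (K L : finType) (P : K -> nat) (Q : L -> nat)
    (T : tensor R (cat_dims P Q)) : tensor R (cons_dims (merged_size P) Q) :=
  fun y =>
    \sum_(x : midx (cat_dims P Q) |
      (linearize (N := P) (fun r => x (inl r)) == y None) &&
      [forall k, x (inr k) == y (Some k)]) T x.

Definition cons_mx (K : finType) (M M' : nat) (Q Q' : K -> nat)
    (Z : 'M[R]_(M, M')) (V : forall k, 'M[R]_(Q k, Q' k)) (o : option K) :
    'M[R]_(cons_dims M Q o, cons_dims M' Q' o) :=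
  match o with None => Z | Some k => V k end.

Definition cat_mx (K L : finType) (P P' : K -> nat) (Q Q' : L -> nat)
    (U : forall r, 'M[R]_(P r, P' r)) (V : forall k, 'M[R]_(Q k, Q' k))
    (s : K + L) : 'M[R]_(cat_dims P Q s, cat_dims P' Q' s) :=
  match s with inl r => U r | inr k => V k end.

End Unfoldings.

Section UnfoldingEntries.
Variable R : nzRingType.

Lemma matricizeE (K S : finType) (I : K -> nat) (m : K) (e : S -> K)
    (T : tensor R I) (x : midx I) :
    (forall k, k != m -> exists s, e s = k) ->
  matricize m e T (x m) (linearize (fun s => x (e s))) = T x.
Proof.
move=> eP; rewrite mxE (big_pred1 x) // => y /=.
apply/andP/eqP => [[/eqP eqm /eqP /linearize_eqP eqe]|-> //].
apply/ffunP => k; case: (eqVneq k m) => [-> //|/eP [s <-]]; exact: eqe.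
Qed.

Lemma mat_leadE (K : finType) (M : nat) (Q : K -> nat)
    (T : tensor R (cons_dims M Q)) (x : midx (cons_dims M Q)) :
  mat_lead T (x None) (linearize (N := Q) (fun k => x (Some k))) = T x.
Proof. by apply: matricizeE => -[k|] // _; exists k. Qed.

Lemma mat_atE (K : finType) (M : nat) (Q : K -> nat) (i : K)
    (T : tensor R (cons_dims M Q)) (x : midx (cons_dims M Q)) :
  mat_at i T (x (Some i)) (linearize (fun o : others (Some i) => x (val o)))
    = T x.
Proof. by apply: matricizeE => k kNi; exists (Sub k kNi). Qed.

Lemma unfold_mxE (K L : finType) (P : K -> nat) (Q : L -> nat)
    (T : tensor R (cat_dims P Q)) (x : midx (cat_dims P Q)) :
  unfold_mx T (linearize (N := P) (fun r => x (inl r)))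
              (linearize (N := Q) (fun k => x (inr k))) = T x.
Proof.
rewrite mxE (big_pred1 x) // => y /=.
apply/andP/eqP => [[/eqP/linearize_eqP eql /eqP/linearize_eqP eqr]|-> //].
by apply/ffunP => -[r|k]; [exact: (eql r) | exact: (eqr k)].
Qed.

Lemma merge_leadE (K L : finType) (P : K -> nat) (Q : L -> nat)
    (T : tensor R (cat_dims P Q)) (x : midx (cat_dims P Q))
    (y : midx (cons_dims (merged_size P) Q)) :
    y None = linearize (N := P) (fun r => x (inl r)) ->
    (forall k, y (Some k) = x (inr k)) ->
  merge_lead T y = T x.
Proof.
move=> yN yS; rewrite /merge_lead (big_pred1 x) // => z /=; rewrite yN.
apply/andP/eqP => [[/eqP/linearize_eqP eql /forallP eqr]|->].
  apply/ffunP => -[r|k]; first exact: (eql r).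
  by rewrite (eqP (eqr k)) yS.
by split; [exact: eqxx | apply/forallP => k; rewrite yS].
Qed.

End UnfoldingEntries.

Definition frobenius (R : rcfType) (m n : nat) (A : 'M[R]_(m, n)) : R :=
  Num.sqrt (\sum_i \sum_j A i j ^+ 2).

Definition thin_svd (R : realDomainType) (m n : nat) (A U : 'M[R]_(m, n))
    (D W : 'M[R]_n) : Prop :=
  [/\ U^T *m U = 1%:M,
      is_diag_mx D /\ (forall k, 0 <= D k k),
      W^T *m W = 1%:M /\ W *m W^T = 1%:M &
      A = U *m D *m W^T].

Definition is_argmin (T : Type) (R : realDomainType) (feasible : T -> Prop)
    (f : T -> R) (v : T) : Prop :=
  feasible v /\ forall w, feasible w -> f v <= f w.

(* Main.v *)
(* The fitted values are themselves a Tucker-type tensor in the merged cores: *)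
(* X_j(1) B_j is the mode-1 matricization of C~_j x_1 Z_j x_2 V_1 ... , whose *)
(* matricization along output mode i is V_i S_j. Both matricizations of a     *)
(* tensor have the same entries, so the objective is |Y_[i] - V_i S|^2, i.e.  *)
(* an orthogonal Procrustes problem. On the feasible set this equals          *)
(* |Y_[i]|^2 + |S|^2 - 2 tr(V_i^T R D W^T), and the trace is the sum of the   *)
(* diagonal entries of (V_i W)^T R weighted by those of D; each of the former *)
(* is an inner product of two unit vectors, hence at most 1, with equality    *)
(* when V_i W = R.                                                            *)
Require Import Defs.
From mathcomp Require Import all_boot all_order all_algebra.
From mathcomp Require Import reals.

Set Implicit Arguments.
Unset Strict Implicit.
Unset Printing Implicit Defensive.

Import Order.TTheory GRing.Theory Num.Theory.
Local Open Scope ring_scope.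

(** Everything rests on reading one residual tensor in two ways. By [matricize_multi_mode_prod] a
    Tucker product unfolds along any mode as factor, core unfolding, transposed Kronecker product:
    the leading mode gives the stated objective (via [unfold_multi_mode_prod] and
    [mat_lead_merge_lead]), output mode [i] isolates the unknown factor. [frobenius_mat_lead_at]
    equates the two norms and [procrustes] solves the resulting problem. *)

Lemma eq_kron_rev (R : nzRingType) (S : finType) (I J : S -> nat)
    (A B : forall k, 'M[R]_(I k, J k)) :
  (forall k, A k = B k) -> kron_rev A = kron_rev B.
Proof.
move=> eqAB; rewrite /kron_rev /merged_size.
by elim: (enum S) => //= k s ->; rewrite eqAB.
Qed.

Lemma kron_rev_linearizeE (R : comNzRingType) (S : finType) (I J : S -> nat)
    (A : forall k, 'M[R]_(I k, J k)) (x : forall k, 'I_(I k))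
    (y : forall k, 'I_(J k)) :
  kron_rev A (linearize x) (linearize y) = \prod_k A k (x k) (y k).
Proof.
have lin (N : S -> nat) (z : forall k, 'I_(N k)) :
    linearize z = linearize ([ffun k => z k] : midx N).
  by apply/linearize_eqP => k; rewrite ffunE.
by rewrite (lin I x) (lin J y) kron_revE; apply: eq_bigr => k _; rewrite !ffunE.
Qed.

Lemma big_neq_codom (R : Type) (idx : R) (op : Monoid.com_law idx)
    (K S : finType) (m : K) (e : S -> K) (F : K -> R) :
    injective e -> (forall k, (k != m) = (k \in codom e)) ->
  \big[op/idx]_(k | k != m) F k = \big[op/idx]_s F (e s).
Proof.
move=> inj_e codom_e; rewrite (eq_bigl _ _ codom_e).
by rewrite -big_uniq /= ?/codom ?big_image // map_inj_uniq // enum_uniq.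
Qed.

Lemma card_midx (K : finType) (I : K -> nat) : #|midx I| = (\prod_k I k)%N.
Proof. by rewrite (bij_eq_card (linearize_bij I)) card_ord merged_sizeE. Qed.

Lemma matricize_bij (K S : finType) (I : K -> nat) (m : K) (e : S -> K) :
    injective e -> (forall k, (k != m) = (k \in codom e)) ->
  bijective (fun x : midx I => (x m, linearize (fun s => x (e s)))).
Proof.
move=> inj_e codom_e; apply: inj_card_bij => [x y [eqm /linearize_eqP eqe]|].
  apply/ffunP => k; case: (eqVneq k m) => [-> //|].
  by rewrite codom_e => /codomP[s ->]; exact: eqe.
rewrite card_prod !card_ord card_midx merged_sizeE (bigD1 m) //=.
by rewrite (big_neq_codom _ _ inj_e codom_e).
Qed.

Lemma unfold_bij (K L : finType) (P : K -> nat) (Q : L -> nat) :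
  bijective (fun x : midx (cat_dims P Q) =>
    (linearize (N := P) (fun r => x (inl r)),
     linearize (N := Q) (fun k => x (inr k)))).
Proof.
apply: inj_card_bij => [x y [/linearize_eqP eql /linearize_eqP eqr]|].
  by apply/ffunP => -[r|k]; [apply: (eql r) | apply: (eqr k)].
by rewrite card_prod !card_ord card_midx !merged_sizeE big_sumType.
Qed.

(** The middle matrix is the common shape of [matricize] and [unfold_mx]. The fibres of [(f, g)]
    partition [T], so the double matrix product collapses to one sum over multi-indices, the form of
    [multi_mode_prodE]. *)
Lemma mulmx_fiber (R : comNzRingType) (T : finType) (m n m' n' : nat)
    (f : T -> 'I_m') (g : T -> 'I_n') (F : T -> R)
    (A : 'M[R]_(m, m')) (B : 'M[R]_(n, n')) a c :
  (A *m (\matrix_(b, b') \sum_(x | (f x == b) && (g x == b')) F x) *m B^T) a c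
  = \sum_x F x * (A a (f x) * B c (g x)).
Proof.
rewrite mxE (partition_big g xpredT) //=; apply: eq_bigr => b' _.
rewrite !mxE big_distrl (partition_big f xpredT) //=; apply: eq_bigr => b _.
rewrite mxE mulrAC big_distrr /=.
apply: eq_big => [x|x /andP[/eqP <- /eqP <-]]; first by rewrite andbC.
by rewrite mulrC.
Qed.

Lemma matricize_multi_mode_prod (R : comNzRingType) (K S : finType)
    (I J : K -> nat) (A : forall k, 'M[R]_(J k, I k)) (T : tensor R I)
    (m : K) (e : S -> K) :
    injective e -> (forall k, (k != m) = (k \in codom e)) ->
  matricize m e (multi_mode_prod A T) =
  A m *m matricize m e T *m (kron_rev (fun s => A (e s)))^T.
Proof.
move=> inj_e codom_e; apply/matrixP => a c.
(* By surjectivity an arbitrary entry [(a, c)] is addressed by a multi-index [x]. *)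
have [y _ yK] := matricize_bij J inj_e codom_e.
move: (y _) (yK (a, c)) => x [<- <-].
rewrite matricizeE => [|k]; last by rewrite codom_e => /codomP[s ->]; exists s.
rewrite multi_mode_prodE mulmx_fiber; apply: eq_bigr => z _; congr (_ * _).
by rewrite (bigD1 m) //= kron_rev_linearizeE (big_neq_codom _ _ inj_e codom_e).
Qed.

Lemma unfold_multi_mode_prod (R : comNzRingType) (K L : finType)
    (P P' : K -> nat) (Q Q' : L -> nat) (U : forall r, 'M[R]_(P r, P' r))
    (V : forall k, 'M[R]_(Q k, Q' k)) (C : tensor R (cat_dims P' Q')) :
  unfold_mx (multi_mode_prod (cat_mx U V) C) =
  kron_rev U *m unfold_mx C *m (kron_rev V)^T.
Proof.
apply/matrixP => a c; have [y _ yK] := unfold_bij P Q.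
move: (y _) (yK (a, c)) => x [<- <-].
rewrite unfold_mxE multi_mode_prodE mulmx_fiber; apply: eq_bigr => z _.
by rewrite big_sumType /= !kron_rev_linearizeE.
Qed.

(** Merging already linearizes the left modes, so the merged mode serves directly as the row
    index. *)
Lemma mat_lead_merge_lead (R : nzRingType) (K L : finType)
    (P : K -> nat) (Q : L -> nat) (C : tensor R (cat_dims P Q)) :
  mat_lead (merge_lead C) = unfold_mx C.
Proof.
apply/matrixP => a c; have [y _ yK] := unfold_bij P Q.
move: (y _) (yK (a, c)) => x [<- <-].
pose z : midx (cons_dims (merged_size P) Q) :=
  [ffun o => match o return 'I_(cons_dims (merged_size P) Q o) with
             | None => linearize (N := P) (fun r => x (inl r))
             | Some k => x (inr k)
             end].
have zN : z None = linearize (N := P) (fun r => x (inl r)) by rewrite ffunE.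
have zS k : z (Some k) = x (inr k) by rewrite ffunE.
have eqc : linearize (N := Q) (fun k => z (Some k)) =
           linearize (N := Q) (fun k => x (inr k)) by apply/linearize_eqP.
by rewrite unfold_mxE -zN -eqc mat_leadE; apply: merge_leadE.
Qed.

Lemma matricize_sub_sum (R : nzRingType) (K S J : finType) (I : K -> nat)
    (m : K) (e : S -> K) (Y : tensor R I) (T : J -> tensor R I) :
  matricize m e (fun x => Y x - \sum_j T j x) =
  matricize m e Y - \sum_j matricize m e (T j).
Proof.
apply/matrixP => a c; rewrite mxE sumrB exchange_big !mxE summxE.
by congr (_ - _); apply: eq_bigr => j _; rewrite mxE.
Qed.

Lemma frobenius_sqr (R : rcfType) m n (A : 'M[R]_(m, n)) :
  frobenius A ^+ 2 = \sum_i \sum_j A i j ^+ 2.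
Proof.
rewrite sqr_sqrtr //; apply: sumr_ge0 => i _; apply: sumr_ge0 => j _.
exact: sqr_ge0.
Qed.

Lemma frobenius_sqr_tr (R : rcfType) m n (A : 'M[R]_(m, n)) :
  frobenius A ^+ 2 = \tr (A *m A^T).
Proof.
rewrite frobenius_sqr; apply: eq_bigr => i _; rewrite mxE.
by apply: eq_bigr => j _; rewrite mxE expr2.
Qed.

(** The right-hand side mentions neither [m] nor [e], so all matricizations of a tensor have the
    same norm. *)
Lemma frobenius_matricize (R : rcfType) (K S : finType) (I : K -> nat)
    (m : K) (e : S -> K) (T : tensor R I) :
    injective e -> (forall k, (k != m) = (k \in codom e)) ->
  frobenius (matricize m e T) ^+ 2 = \sum_x T x ^+ 2.
Proof.
move=> inj_e codom_e; rewrite frobenius_sqr pair_bigA /=.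
rewrite (reindex _ (onW_bij _ (matricize_bij I inj_e codom_e))) /=.
apply: eq_bigr => x _; rewrite matricizeE // => k.
by rewrite codom_e => /codomP[s ->]; exists s.
Qed.

Lemma codom_Some (K : finType) (o : option K) :
  (o != None) = (o \in codom Some).
Proof.
case: o => [k|]; first by rewrite codom_f.
by apply/esym/codomP => -[].
Qed.

Lemma codom_others (K : finType) (m k : K) :
  (k != m) = (k \in codom (fun o : others m => val o)).
Proof.
apply/idP/codomP => [km|[o ->]]; last exact: valP o.
by exists (Sub k km).
Qed.

Lemma frobenius_mat_lead_at (R : rcfType) (K : finType) (M : nat)
    (Q : K -> nat) (i : K) (T : tensor R (cons_dims M Q)) :
  frobenius (mat_lead T) ^+ 2 = frobenius (mat_at i T) ^+ 2.
Proof.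
rewrite (frobenius_matricize T (@Some_inj _) (@codom_Some _)).
by apply/esym/frobenius_matricize; [apply: val_inj | apply: codom_others].
Qed.

Lemma mxtrace_mul_diag (R : nzRingType) n (G D : 'M[R]_n) :
  is_diag_mx D -> \tr (G *m D) = \sum_k G k k * D k k.
Proof.
move=> /is_diag_mxP diagD; apply: eq_bigr => k _.
rewrite mxE (bigD1 k) //= big1 ?addr0 // => h hk.
by rewrite diagD ?mulr0.
Qed.

(** Twice the gap to 1 is the squared distance between two unit columns. *)
Lemma orthonormal_col_dot_le1 (R : realDomainType) m n (A B : 'M[R]_(m, n)) k :
  A^T *m A = 1%:M -> B^T *m B = 1%:M -> (A^T *m B) k k <= 1.
Proof.
have unit_col (E : 'M[R]_(m, n)) : E^T *m E = 1%:M -> \sum_h E h k ^+ 2 = 1.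
  move=> /matrixP/(_ k k); rewrite !mxE eqxx => EE; rewrite -[RHS]EE.
  by apply: eq_bigr => h _; rewrite mxE expr2.
move=> /unit_col A1 /unit_col B1.
rewrite -subr_ge0 -(pmulrn_lge0 _ (isT : (0 < 2)%N)).
have -> : (1 - (A^T *m B) k k) *+ 2 = \sum_h (A h k - B h k) ^+ 2.
  under eq_bigr do rewrite sqrrB.
  rewrite big_split sumrB /= A1 B1 sumrMnl mxE mulrnBl.
  rewrite mulr2n addrAC; congr (_ - _ *+ 2 + _).
  by apply: eq_bigr => h _; rewrite mxE.
by apply: sumr_ge0 => h _; apply: sqr_ge0.
Qed.

(** Orthonormality turns the quadratic term in [V] into the constant [frobenius S ^+ 2]; [V]
    survives only in a linear trace term. *)
Lemma frobenius_sqr_residual (R : rcfType) m n q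
    (Y : 'M[R]_(m, n)) (S : 'M[R]_(q, n)) (V : 'M[R]_(m, q)) :
    V^T *m V = 1%:M ->
  frobenius (Y - V *m S) ^+ 2 =
  frobenius Y ^+ 2 + frobenius S ^+ 2 - \tr (V^T *m (Y *m S^T)) *+ 2.
Proof.
move=> VV; rewrite !frobenius_sqr_tr linearB /= trmx_mul.
rewrite mulmxBl !mulmxBr !linearB /=.
have -> : \tr (V *m S *m (S^T *m V^T)) = \tr (S *m S^T).
  by rewrite -mulmxA mxtrace_mulC -!mulmxA VV mulmx1.
have -> : \tr (V *m S *m Y^T) = \tr (V^T *m (Y *m S^T)).
  by rewrite -mxtrace_tr !trmx_mul trmxK mulmxA mxtrace_mulC.
have -> : \tr (Y *m (S^T *m V^T)) = \tr (V^T *m (Y *m S^T)).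
  by rewrite mulmxA mxtrace_mulC.
by rewrite mulr2n opprB opprD !addrA; congr (_ - _); rewrite addrAC.
Qed.

Lemma procrustes (R : rcfType) m n q (Y : 'M[R]_(m, n)) (S : 'M[R]_(q, n))
    (Rm : 'M[R]_(m, q)) (D W : 'M[R]_q) :
    thin_svd (Y *m S^T) Rm D W ->
  is_argmin (fun V : 'M[R]_(m, q) => V^T *m V = 1%:M)
    (fun V => frobenius (Y - V *m S) ^+ 2) (Rm *m W^T).
Proof.
case=> RR [diagD D0] [WTW WWT] svd.
have feas : (Rm *m W^T)^T *m (Rm *m W^T) = 1%:M.
  by rewrite trmx_mul trmxK mulmxA -(mulmxA W) RR mulmx1.
split=> // V VV; rewrite !frobenius_sqr_residual // lerD2l lerN2 ler_wMn2r //.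
have trE E : \tr (E^T *m (Y *m S^T)) = \sum_k ((E *m W)^T *m Rm) k k * D k k.
  rewrite svd -mxtrace_mul_diag // trmx_mul [LHS]mxtrace_mulC.
  by rewrite -!mulmxA mxtrace_mulC -!mulmxA mxtrace_mulC -!mulmxA.
(* As [D] is nonnegative, diagonal entries are compared one by one; the candidate gives the
   identity, hence 1 at each. *)
rewrite !trE; apply: ler_sum => k _; apply: ler_wpM2r => //.
rewrite -[Rm *m W^T *m W]mulmxA WTW mulmx1 RR [leRHS]mxE eqxx.
apply: orthonormal_col_dot_le1 => //.
by rewrite trmx_mul mulmxA -(mulmxA W^T) VV mulmx1.
Qed.

Theorem proposition3 (R : realType) (M p d : nat)
  (hM : (0 < M)%N) (hp : (0 < p)%N) (hd : (0 < d)%N)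
  (Q Qt : 'I_d -> nat) (hQ : forall k, (Qt k <= Q k)%N)
  (l : 'I_p -> nat) (P Pt : forall j : 'I_p, 'I_(l j) -> nat)
  (Y : tensor R (cons_dims M Q))
  (X : forall j : 'I_p, tensor R (cons_dims M (P j)))
  (U : forall (j : 'I_p) (r : 'I_(l j)), 'M[R]_(P j r, Pt j r))
  (C : forall j : 'I_p, tensor R (cat_dims (Pt j) Qt))
  (i : 'I_d)
  (* The component V i is overwritten in B and unused in S. *)
  (V : forall k : 'I_d, 'M[R]_(Q k, Qt k)) :
  let B (Vi : 'M[R]_(Q i, Qt i)) (j : 'I_p) : tensor R (cat_dims (P j) Q) :=
    multi_mode_prod (cat_mx (U j) (dfwith V Vi)) (C j) in
  let Z (j : 'I_p) := mat_lead (X j) *m kron_rev (U j) in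
  let S :=
    \sum_(j < p) mat_at i (merge_lead (C j)) *m
      (kron_rev (fun o : others (Some i) => cons_mx (Z j) V (val o)))^T in
  forall (Rm : 'M[R]_(Q i, Qt i)) (D W : 'M[R]_(Qt i)),
  thin_svd (mat_at i Y *m S^T) Rm D W ->
  is_argmin
    (fun Vi : 'M[R]_(Q i, Qt i) => Vi^T *m Vi = 1%:M)
    (fun Vi : 'M[R]_(Q i, Qt i) =>
       frobenius (mat_lead Y -
                  \sum_(j < p) mat_lead (X j) *m unfold_mx (B Vi j)) ^+ 2)
    (Rm *m W^T).
Proof.
move=> B Z S Rm D W svd.
(* The fitted tensor of block [j], with [Z j] acting on the merged mode. *)
pose T (Vi : 'M[R]_(Q i, Qt i)) j : tensor R (cons_dims M Q) :=
  multi_mode_prod (cons_mx (Z j) (dfwith V Vi)) (merge_lead (C j)).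
have T_lead Vi j : mat_lead (X j) *m unfold_mx (B Vi j) = mat_lead (T Vi j).
  rewrite [RHS](matricize_multi_mode_prod _ _ (@Some_inj _) (@codom_Some _)).
  rewrite unfold_multi_mode_prod -[matricize _ _ (merge_lead _)]/(mat_lead _).
  by rewrite mat_lead_merge_lead !mulmxA.
have T_at Vi j : mat_at i (T Vi j) = Vi *m (mat_at i (merge_lead (C j)) *m
    (kron_rev (fun o : others (Some i) => cons_mx (Z j) V (val o)))^T).
  rewrite [LHS](matricize_multi_mode_prod (e := fun o : others _ => val o)
    _ _ val_inj (@codom_others _ _)) /=.
  (* Away from mode [i] the override by [Vi] is invisible, so the Kronecker factor is independent of
     [Vi]. *)
  rewrite dfwith_in mulmxA; congr (_ *m _^T); apply: eq_kron_rev.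
  by move=> [[k|] ki] //=; rewrite dfwith_out // eq_sym.
have obj Vi : frobenius (mat_lead Y -
      \sum_(j < p) mat_lead (X j) *m unfold_mx (B Vi j)) ^+ 2 =
    frobenius (mat_at i Y - Vi *m S) ^+ 2.
  under eq_bigr do rewrite T_lead.
  rewrite mulmx_sumr -(eq_bigr _ (fun j _ => T_at Vi j)).
  (* Both residual matrices are matricizations of this single tensor. *)
  have := frobenius_mat_lead_at i (fun x => Y x - \sum_j T Vi j x).
  by rewrite /mat_lead /mat_at !matricize_sub_sum.
have [feas opt] := procrustes svd.
by split=> // Vi /opt; rewrite !obj.
Qed.
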